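(* A one-dimensional local Mori domain $R$ is locally tame. Moreover, $R$ is globally tame if and only if $\Lambda(R)=\infty$.
   Context: A domain is a commutative integral domain; a monoid is a commutative cancellative semigroup with identity. ''Local'' means having a unique maximal ideal, not necessarily noetherian; ''one-dimensional'' means Krull dimension one. A domain $R$ with quotient field $K$ is Mori if it satisfies the ascending chain condition on integral divisorial ideals, i.e. ideals $I\subseteq R$ of the form $I=(R:(R:X))$ with $X\subseteq K$, where $(R:Y)=\{z\in K: zY\subseteq R\}$. Mori domains are atomic. Arithmetical notions for $R$ are those of the monoid $H=R^\bullet=R\setminus\{0\}$. For a monoid $H$: $H^\times$ is the unit group, $\mathcal A(H)$ the set of atoms, $H_{\rm red}=\{aH^\times:a\in H\}$, $\mathsf Z(H)$ the free abelian monoid on $\mathcal A(H_{\rm red})$, $\pi:\mathsf Z(H)\to H_{\rm red}$ the canonical homomorphism, $\mathsf Z(a)=\pi^{-1}(aH^\times)$, $|z|$ the length of $z\in\mathsf Z(H)$, and $\mathsf L(a)=\{|z|:z\in\mathsf Z(a)\}\subseteq\mathbb N_0$. For $z,z'\in\mathsf Z(H)$, after cancelling their greatest common divisor in $\mathsf Z(H)$ they become products of $m$ and $n$ atoms respectively, and $\mathsf d(z,z')=\max\{m,n\}$. $\Lambda(H)=\sup\{\min\mathsf L(a):a\in H\}\in\mathbb N_0\cup\{\infty\}$, and $\Lambda(R)=\Lambda(R^\bullet)$. For $u\in\mathcal A(H_{\rm red})$, $\mathsf t(u)$ is the smallest $N\in\mathbb N_0\cup\{\infty\}$ such that whenever $a\in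 H$ with $\mathsf Z(a)\cap u\mathsf Z(H)\ne\emptyset$ and $z\in\mathsf Z(a)$, there is $z'\in\mathsf Z(a)\cap u\mathsf Z(H)$ with $\mathsf d(z,z')\le N$. $H$ is locally tame if $\mathsf t(u)<\infty$ for all $u\in\mathcal A(H_{\rm red})$, and globally tame if $\sup\{\mathsf t(u):u\in\mathcal A(H_{\rm red})\}<\infty$. *)

(* Defs.v *)
From HB Require Import structures.
From mathcomp Require Import all_boot all_order all_algebra.
From mathcomp Require Import finmap multiset.
From mathcomp Require Import boolp classical_sets.

Set Implicit Arguments.
Unset Strict Implicit.
Unset Printing Implicit Defensive.

Local Open Scope classical_set_scope.
Local Open Scope quotient_scope.

(* [Some n] is the natural number [n], [None] is infinity. *)
Definition natbar := option nat.
Definition natbar_oo : natbar := None.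

Definition natbar_le_nat (x : natbar) (N : nat) : Prop :=
  if x is Some n then (n <= N)%N else False.

(* By convention the minimum of the empty set is oo. *)
Definition natbar_min (P : set nat) : natbar :=
  xget natbar_oo [set x | exists2 n, x = Some n &
                            P n /\ forall m, P m -> (n <= m)%N].

(* The least natural upper bound, or oo if there is none. *)
Definition natbar_sup (S : set natbar) : natbar :=
  natbar_min [set N | forall x, S x -> natbar_le_nat x N].

HB.mixin Record Monoid_isComCancel H of Monoid H := {
  cmonC : forall x y : H, (x * y = y * x)%g;
  cmonI : forall x y z : H, (x * y = x * z)%g -> y = z
}.

#[short(type="cmonoidType")]
HB.structure Definition CMonoid := {H of Monoid H & Monoid_isComCancel H}.

Section MonoidDefs.
Local Open Scope group_scope.
Variable H : cmonoidType.
Implicit Types x y a b : H.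

Definition munit x : Prop := exists y, x * y = 1.

Definition matom x : Prop :=
  ~ munit x /\ forall a b, x = a * b -> munit a \/ munit b.

(* This is equality of the cosets a H^x and b H^x; [mred] below is H_red. *)
Definition massoc a b : bool := `[< exists2 e, munit e & b = a * e >].

Lemma munitM x y : munit x -> munit y -> munit (x * y).
Proof.
move=> [x' hx] [y' hy]; exists (y' * x').
by rewrite mulgA -(mulgA x) hy mulg1.
Qed.

Lemma massoc_refl : reflexive massoc.
Proof.
move=> a; apply/asboolP; exists 1; rewrite ?mulg1 //.
by exists 1; rewrite mulg1.
Qed.

Lemma massoc_symW a b : massoc a b -> massoc b a.
Proof.
move=> /asboolP[e [e' he] ->]; apply/asboolP; exists e'.
  by exists e; rewrite cmonC.
by rewrite -mulgA he mulg1.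
Qed.

Lemma massoc_sym : symmetric massoc.
Proof. by move=> a b; apply/idP/idP; apply: massoc_symW. Qed.

Lemma massoc_trans : transitive massoc.
Proof.
move=> b a c /asboolP[e he ->] /asboolP[f hf ->]; apply/asboolP.
by exists (e * f); [exact: munitM | rewrite mulgA].
Qed.

Canonical massoc_equiv := EquivRel massoc massoc_refl massoc_sym massoc_trans.

Definition mred := {eq_quot massoc}.

HB.instance Definition _ : EqQuotient H massoc mred := EqQuotient.on mred.
HB.instance Definition _ := Choice.on mred.

Lemma mred_eqP a b :
  reflect (exists2 e, munit e & b = a * e) (\pi_mred a == \pi_mred b).
Proof. by rewrite eqmodE; exact: asboolP. Qed.

Definition mred_mul (u v : mred) : mred := \pi_mred (repr u * repr v).
Definition mred_one : mred := \pi_mred 1.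

Lemma mred_ex (u : mred) : exists a, u = \pi_mred a.
Proof. by exists (repr u); rewrite reprK. Qed.

Lemma mred_piM a b : mred_mul (\pi_mred a) (\pi_mred b) = \pi_mred (a * b).
Proof.
have rep c : exists2 e, munit e & repr (\pi_mred c) = c * e.
  by apply/mred_eqP; rewrite reprK.
rewrite /mred_mul; case: (rep a) => e he ->; case: (rep b) => f hf ->.
apply/esym/eqP/mred_eqP; exists (e * f); first exact: munitM.
by rewrite !mulgA; congr (_ * _); rewrite -!mulgA (cmonC e).
Qed.

Lemma mred_mulA : associative mred_mul.
Proof.
move=> u v w; have [a ->] := mred_ex u; have [b ->] := mred_ex v.
have [c ->] := mred_ex w.
by rewrite !mred_piM mulgA.
Qed.

Lemma mred_mulC : commutative mred_mul.
Proof. by move=> u v; rewrite /mred_mul cmonC. Qed.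

Lemma mred_mul1 : left_id mred_one mred_mul.
Proof. by move=> u; have [a ->] := mred_ex u; rewrite mred_piM mul1g. Qed.

Lemma mred_mul1r : right_id mred_one mred_mul.
Proof. by move=> u; rewrite mred_mulC mred_mul1. Qed.

HB.instance Definition _ :=
  isMonoid.Build mred mred_mulA mred_mul1 mred_mul1r.

Lemma mred_mulI : right_injective mred_mul.
Proof.
move=> u v w; have [a ->] := mred_ex u; have [b ->] := mred_ex v.
have [c ->] := mred_ex w; rewrite !mred_piM.
move=> /eqP/mred_eqP[e he]; rewrite -mulgA => /cmonI hvw.
by apply/eqP/mred_eqP; exists e.
Qed.

HB.instance Definition _ :=
  Monoid_isComCancel.Build mred mred_mulC mred_mulI.

End MonoidDefs.

Section Factorizations.
Local Open Scope mset_scope.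
Variable H : cmonoidType.

Definition red_atom := {u : mred H | `[< matom u >]}.

(* Z(H), written additively: the free abelian monoid on A(H_red). *)
Local Notation fmonoid := {mset red_atom}.

Definition fact_pi (z : fmonoid) : mred H := (\prod_(u <- z) val u)%g.

Definition factorizations (a : H) : set fmonoid :=
  [set z | fact_pi z = \pi_(mred H) a].

Definition fact_length (z : fmonoid) : nat := size z.

Definition set_of_lengths (a : H) : set nat :=
  [set fact_length z | z in factorizations a].

(* [z `&` z'] is the greatest common divisor of [z] and [z'] in Z(H), and
   [`\`] is the subtraction of multiplicities, i.e. division in Z(H). *)
Definition fact_dist (z z' : fmonoid) : nat :=
  maxn (fact_length (z `\` (z `&` z'))) (fact_length (z' `\` (z `&` z'))).

Definition fact_multiples (u : red_atom) : set fmonoid :=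
  [set z | exists w : fmonoid, z = [mset u] `+` w].

Definition tame_bound (u : red_atom) (N : nat) : Prop :=
  forall (a : H) (z : fmonoid),
    (factorizations a `&` fact_multiples u)%classic !=set0 ->
    factorizations a z ->
    exists2 z', (factorizations a `&` fact_multiples u)%classic z' &
                (fact_dist z z' <= N)%N.

Definition tame_degree (u : red_atom) : natbar := natbar_min (tame_bound u).

Definition locally_tame : Prop :=
  forall u : red_atom, tame_degree u <> natbar_oo.

Definition globally_tame : Prop :=
  natbar_sup [set tame_degree u | u in [set: red_atom]] <> natbar_oo.

Definition Lambda : natbar :=
  natbar_sup [set natbar_min (set_of_lengths a) | a in [set: H]].

End Factorizations.

Section NonzeroMonoid.
Local Open Scope ring_scope.
Import GRing.Theory.
Variable R : idomainType.

Definition nonzero := {x : R | x != 0}.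

HB.instance Definition _ := Choice.on nonzero.

Lemma nonzero_mul_subproof (x y : nonzero) : val x * val y != 0.
Proof. by rewrite mulf_neq0 ?(valP x) ?(valP y). Qed.

Definition nonzero_mul (x y : nonzero) : nonzero :=
  exist _ (val x * val y) (nonzero_mul_subproof x y).
Definition nonzero_one : nonzero := exist _ 1 (oner_neq0 R).

Lemma nonzero_mulA : associative nonzero_mul.
Proof. by move=> x y z; apply: val_inj; rewrite /= mulrA. Qed.

Lemma nonzero_mulC : commutative nonzero_mul.
Proof. by move=> x y; apply: val_inj; rewrite /= mulrC. Qed.

Lemma nonzero_mul1 : left_id nonzero_one nonzero_mul.
Proof. by move=> x; apply: val_inj; rewrite /= mul1r. Qed.

Lemma nonzero_mul1r : right_id nonzero_one nonzero_mul.
Proof. by move=> x; apply: val_inj; rewrite /= mulr1. Qed.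

HB.instance Definition _ :=
  isMonoid.Build nonzero nonzero_mulA nonzero_mul1 nonzero_mul1r.

Lemma nonzero_mulI : right_injective nonzero_mul.
Proof.
move=> x y z /(congr1 val) /= /(mulfI (valP x)) yz.
exact: val_inj.
Qed.

HB.instance Definition _ :=
  Monoid_isComCancel.Build nonzero nonzero_mulC nonzero_mulI.

End NonzeroMonoid.

Section Domains.
Local Open Scope ring_scope.
Variable R : idomainType.

(* The boolean predicates [idealr R] (proper ideals) and [prime_idealr R]
   range over all subsets of [R], since the logic is classical. *)

Definition maximal_ideal (M : idealr R) : Prop :=
  forall I : idealr R, {subset M <= I} -> I =i M.

Definition local_domain : Prop :=
  exists2 M : idealr R, maximal_ideal M &
    forall M' : idealr R, maximal_ideal M' -> M' =i M.

Definition prime_chain (n : nat) (P : 'I_n.+1 -> prime_idealr R) : Prop :=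
  forall i j : 'I_n.+1, (i < j)%N ->
    {subset P i <= P j} /\ exists2 x, x \in P j & x \notin P i.

Definition krull_dim : natbar :=
  natbar_sup [set Some n | n in
    [set n | exists P : 'I_n.+1 -> prime_idealr R, prime_chain P]].

Definition colon (Y : set {fraction R}) : set {fraction R} :=
  [set z | forall y, Y y -> exists r : R, z * y = tofrac r].

Definition integral_divisorial (I : set {fraction R}) : Prop :=
  I `<=` range (@tofrac R) /\
  exists X : set {fraction R}, I = colon (colon X).

Definition mori_domain : Prop :=
  forall I : nat -> set {fraction R},
    (forall n, integral_divisorial (I n)) ->
    (forall n, I n `<=` I n.+1) ->
    exists N, forall n, (N <= n)%N -> I n = I N.

End Domains.

(* Main.v *)
From HB Require Import structures.
Require Import Defs.
From mathcomp Require Import all_boot all_algebra.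
From mathcomp Require Import finmap multiset.
From mathcomp Require Import zify ring.
From mathcomp Require Import boolp classical_sets.

Set Implicit Arguments.
Unset Strict Implicit.
Unset Printing Implicit Defensive.

(** Only one property of a one-dimensional local Mori domain matters: its
    monoid H of nonzero elements is strongly primary, that is, for every a
    there is n such that every product of at least n nonunits is divisible by
    a ([strongly_primary_nonzero]).  One-dimensionality puts a power of each
    single nonunit into aR ([nonunit_power_dvd]); the chain condition provides
    a finite set E of nonunits with the same colon (R : E) as the maximal ideal
    ([mori_finite_colon]); long products of elements of E lie in aR, and the
    factors can be replaced one at a time by arbitrary nonunits.

    Suppose first that Lambda is finite.  A long factorization of an element
    divisible by u contains a subproduct of bounded length already divisible
    by u, and that subproduct can be refactored as u times boundedly many
    atoms; so H is locally tame ([locally_tame_of_bounded]).  It is not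
    globally tame ([not_globally_tame_of_bounded]): for an atom p, write p^k as
    a product of at most Lambda atoms; a global tameness bound T would make
    each of them divide p^(T+1), hence p^k divide p^((T+1) Lambda) for all k.

    Suppose now that Lambda is infinite, and fix a nonunit q.  Call an
    element q-free if q does not divide it.  The factorizations of q-free
    elements have bounded length, so Lambda would be finite if every power of q
    were, up to a bounded power of q, a product of two q-free elements
    ([bounded_of_power_splits]).  This excludes
    two phenomena.

    (1) For some u, the q-free parts x_m in u^m = q^f x_m do not all divide a
    common power of q ([bounded_parts]).  Indeed the least exponent n with x_m
    dividing q^n grows by bounded steps as m increases, so it would come close
    to every k.

    (2) There are q-free b, and L arbitrarily large, such that
    q^(L i) divides b^(i+1) for all i; in other words, z = b / q^L is almost
    integral and every q^L z^i lies in R.  This is where addition enters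
    ([power_splits_of_saturated]): for 0 < j < L, q^(L-j) z is topologically
    nilpotent, so 1 + q^(L-j) z has an inverse given by a geometric sum, and
    clearing denominators yields q^(2j) = (q^j + b) y with q dividing neither
    factor.

    Let L0 be a bound for the L in (2).  If q does not divide d, then q^(m L0)
    does not divide d^m ([power_order]): otherwise d / q^L0 would be almost
    integral, and a suitable power of it would be an instance of (2).  Apply
    this to an a not divisible by q and to d = q^i / a with i minimal; together
    with (1) the two bounds give i <= 2 L0 ([dvd_fixed_power]).  Hence all atoms
    divide one fixed power of q, and the exchange argument of the first part
    becomes uniform in u ([globally_tame_of_absorbs]). *)

(** * Extended natural numbers *)

Section NatBar.
Local Open Scope nat_scope.

Lemma natbar_minP (P : set nat) (x : natbar) :
  natbar_min P = x <->
  if x is Some n then P n /\ (forall m, P m -> n <= m) else forall n, ~ P n.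
Proof.
rewrite /natbar_min; case: xgetP => [y -> [n ->] [Pn nP]|noP].
  case: x => [k|]; last by split=> // /(_ n).
  split=> [[<-]//|[Pk kP]].
  by congr Some; apply/eqP; rewrite eqn_leq nP // kP.
split=> [<- n Pn|].
  have exP : exists n, `[< P n >] by exists n; apply/asboolP.
  case: (ex_minnP exP) => k /asboolP Pk kP.
  by apply: (noP (Some k)); exists k => //; split=> // m /asboolP/kP.
case: x => [k kP|//]; exfalso.
by apply: (noP (Some k)); exists k.
Qed.

Lemma natbar_min_neqoo (P : set nat) :
  natbar_min P <> natbar_oo <-> exists n, P n.
Proof.
split=> [h|[n Pn]]; last by move=> h; apply: ((natbar_minP P None).1 h n).
by apply: contrapT => noP; apply: h; apply/natbar_minP => n Pn; apply: noP; exists n.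
Qed.

Lemma natbar_min_le (P : set nat) N :
  natbar_le_nat (natbar_min P) N <-> exists2 n, P n & n <= N.
Proof.
move: ((natbar_minP P _).1 erefl); case: (natbar_min P) => [n|] /= h.
  split=> [le|[m /h.2]]; [by exists n; case: h | exact: leq_trans].
by split=> // -[n /h].
Qed.

Lemma natbar_sup_neqoo (S : set natbar) :
  natbar_sup S <> natbar_oo <-> exists N, forall x, S x -> natbar_le_nat x N.
Proof. exact: natbar_min_neqoo. Qed.

End NatBar.

(** * Divisibility in cancellative monoids *)

HB.instance Definition _ (H : cmonoidType) :=
  SemiGroup.isCommutativeLaw.Build H *%g (@cmonC H).

Section Divisibility.
Local Open Scope group_scope.
Variable H : cmonoidType.
Implicit Types (a b c d q u x y : H) (s : seq H).

Definition mdvd a b := exists c, b = a * c.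

Lemma mdvd_trans b a c : mdvd a b -> mdvd b c -> mdvd a c.
Proof. by move=> [x ->] [y ->]; exists (x * y); rewrite mulgA. Qed.

Lemma mdvd_mulr a b : mdvd a (a * b). Proof. by exists b. Qed.

Lemma mdvd_mull a b : mdvd a (b * a). Proof. by exists b; rewrite cmonC. Qed.

Lemma mdvd1 a : mdvd 1 a. Proof. by exists a; rewrite mul1g. Qed.

Lemma cmonACA a b c d : (a * b) * (c * d) = (a * c) * (b * d).
Proof. by rewrite -!mulgA; congr (_ * _); rewrite !mulgA (cmonC b). Qed.

Lemma mdvd_mul a b c d : mdvd a b -> mdvd c d -> mdvd (a * c) (b * d).
Proof. by move=> [x ->] [y ->]; exists (x * y); rewrite cmonACA. Qed.

Lemma mdvd_mul2l c a b : mdvd (c * a) (c * b) -> mdvd a b.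
Proof. by move=> [x]; rewrite -mulgA => /cmonI ->; exists x. Qed.

Lemma mdvd_exp2l q m n : (m <= n)%N -> mdvd (q ^+ m) (q ^+ n).
Proof. by move=> /subnKC <-; rewrite expgnDr; apply: mdvd_mulr. Qed.

Lemma mdvd_exp a b n : mdvd a b -> mdvd (a ^+ n) (b ^+ n).
Proof. by move=> [x ->]; exists (x ^+ n); apply/expgMn/cmonC. Qed.

Lemma mdvd_prod x s : x \in s -> mdvd x (\prod_(y <- s) y).
Proof.
elim: s => // y s IHs; rewrite in_cons big_cons => /orP[/eqP <-|/IHs].
  exact: mdvd_mulr.
by move=> h; apply: mdvd_trans h (mdvd_mull _ _).
Qed.

Lemma munit_dvd a b : mdvd a b -> munit b -> munit a.
Proof. by move=> [c ->] [d cd]; exists (c * d); rewrite mulgA. Qed.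

Lemma mdvd_exp_leq q m n : ~ munit q -> mdvd (q ^+ m) (q ^+ n) -> (m <= n)%N.
Proof.
move=> qN; rewrite leqNgt => h; apply/negP => nm; apply: qN.
move: h; rewrite -(subnKC nm) addSnnS expgnDr => -[c].
rewrite -mulgA -[LHS]mulg1 => /cmonI hc.
by apply: (@munit_dvd _ 1); [rewrite hc expgS -mulgA; apply: mdvd_mulr | exists 1; rewrite mulg1].
Qed.

(** * Strongly primary monoids *)

(** The inclusion in aH of the n-th power of the set of nonunits, phrased with
    products of at least n factors so that it is visibly monotone in n. *)
Definition absorbs a n := forall s,
  {in s, forall x, ~ munit x} -> (n <= size s)%N -> mdvd a (\prod_(x <- s) x).

Definition strongly_primary := forall a, exists n, absorbs a n.

Lemma absorbs_dvd a b n : mdvd a b -> absorbs b n -> absorbs a n.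
Proof. by move=> ab bn s sN ns; apply: mdvd_trans ab (bn s sN ns). Qed.

Lemma absorbsM a b m n : absorbs a m -> absorbs b n -> absorbs (a * b) (m + n).
Proof.
move=> am bn s sN mns; rewrite -(cat_take_drop m s) big_cat /=.
have ms : (m <= size s)%N by apply: leq_trans mns; apply: leq_addr.
apply: mdvd_mul; [apply: am | apply: bn].
- by move=> x /mem_take /sN.
- by rewrite size_takel.
- by move=> x /mem_drop /sN.
- by rewrite size_drop leq_subRL.
Qed.

Lemma absorbs1 : absorbs 1 0. Proof. by move=> s _ _; apply: mdvd1. Qed.

Lemma absorbsX a n k : absorbs a n -> absorbs (a ^+ k) (k * n).
Proof.
move=> an; elim: k => [|k IHk]; first exact: absorbs1.
by rewrite expgS mulSn; apply: absorbsM.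
Qed.

Lemma prodg_nseq n q : \prod_(x <- nseq n q) x = q ^+ n.
Proof. by elim: n => [|n IHn]; rewrite ?big_nil //= big_cons IHn expgS. Qed.

Lemma absorbs_exp a q n : ~ munit q -> absorbs a n -> mdvd a (q ^+ n).
Proof.
move=> qN an; rewrite -prodg_nseq; apply: an; last by rewrite size_nseq.
by move=> x /nseqP[-> _].
Qed.

(** If s were longer than n, its first n factors would already be divisible by
    the whole product a, and the remaining ones would be units. *)
Lemma absorbs_length a s n :
  absorbs a n -> {in s, forall x, ~ munit x} -> \prod_(x <- s) x = a ->
  (size s <= n)%N.
Proof.
move=> an sN sa; rewrite leqNgt; apply/negP => ns.
have [c hc] : mdvd a (\prod_(x <- take n s) x).
  by apply: an; [move=> x /mem_take /sN | rewrite size_takel // ltnW].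
move: sa; rewrite -(cat_take_drop n s) big_cat /= hc -mulgA -[RHS]mulg1.
move/cmonI; case def_t: (drop n s) => [|x t].
  by move: ns; rewrite -subn_gt0 -size_drop def_t.
have xs : x \in s by apply: (@mem_drop n); rewrite def_t mem_head.
rewrite big_cons mulgA (cmonC c) -mulgA => hx.
by case: (sN x xs); exists (c * \prod_(y <- t) y).
Qed.

(** A bound for the number of nonunits in a product equal to a strictly
    decreases when a is replaced by a proper factor: this is the induction. *)
Lemma atomic_factorization a : strongly_primary -> ~ munit a ->
  exists2 s, {in s, forall x, matom x} & \prod_(x <- s) x = a.
Proof.
move=> sp; have [n /absorbs_length an] := sp a.
have {an} : forall s, {in s, forall x, ~ munit x} -> \prod_(x <- s) x = a ->
  (size s <= n)%N by move=> s; apply: an.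
elim: n a => [|n IHn] a bound_a aN.
  have : (size [:: a] <= 0)%N.
    by apply: bound_a; rewrite ?big_seq1 // => x /[!inE] /eqP ->.
  by [].
have [aA|aA] := pselect (matom a).
  by exists [:: a]; rewrite ?big_seq1 // => x /[!inE] /eqP ->.
have /contrapT[x [y [ax xN yN]]] : ~ ~ exists x y, [/\ a = x * y, ~ munit x & ~ munit y].
  move=> noxy; apply: aA; split=> // x y axy.
  have [|xN] := pselect (munit x); first by left.
  by right; apply: contrapT => yN; apply: noxy; exists x, y.
have half b c : a = b * c -> ~ munit b -> ~ munit c ->
    exists2 s, {in s, forall x, matom x} & \prod_(x <- s) x = b.
  move=> abc bN cN; apply: IHn => // s sN sb.
  rewrite -ltnS; apply: (bound_a (c :: s)); last by rewrite big_cons sb cmonC.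
  by move=> z; rewrite in_cons => /orP[/eqP -> //|/sN].
have [s sA sx] := half _ _ ax xN yN.
have [t tA ty] := half y x (etrans ax (cmonC _ _)) yN xN.
exists (s ++ t); last by rewrite big_cat /= sx ty ax.
by move=> z; rewrite mem_cat => /orP[/sA|/tA].
Qed.

(** Every a divides a power of q, which bounds the powers of q dividing a; so a
    has a q-free part x. *)
Lemma order_ex q a : strongly_primary -> ~ munit q ->
  exists f x, a = q ^+ f * x /\ ~ mdvd q x.
Proof.
move=> sp qN; have [n /(absorbs_exp qN) aqn] := sp a.
have ex0 : exists f, `[< mdvd (q ^+ f) a >] by exists 0; apply/asboolP/mdvd1.
have bnd f : `[< mdvd (q ^+ f) a >] -> (f <= n)%N.
  by move=> /asboolP qfa; apply: (mdvd_exp_leq qN); apply: mdvd_trans aqn.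
case: (ex_maxnP ex0 bnd) => f /asboolP[x ax] fmax; exists f, x; split=> // -[y xy].
have : (f.+1 <= f)%N; last by rewrite ltnn.
by apply/fmax/asboolP; exists y; rewrite ax xy expgSr mulgA.
Qed.

Lemma order_geq q f x k :
  mdvd (q ^+ k) (q ^+ f * x) -> ~ mdvd q x -> (k <= f)%N.
Proof.
move=> h qx; rewrite leqNgt; apply/negP => fk; apply: qx.
move: h; rewrite -(subnKC fk) addSnnS expgnDr => /mdvd_mul2l.
by apply: mdvd_trans; rewrite expgS; apply: mdvd_mulr.
Qed.

End Divisibility.
(** * The associated reduced monoid *)

Section Reduced.
Local Open Scope group_scope.
Local Open Scope quotient_scope.
Variable H : cmonoidType.
Implicit Types (a b : H) (u v : mred H).

Lemma pi_mredM a b : \pi_(mred H) (a * b) = \pi_(mred H) a * \pi_(mred H) b.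
Proof. exact/esym/mred_piM. Qed.

Lemma pi_mredX a n : \pi_(mred H) (a ^+ n) = \pi_(mred H) a ^+ n.
Proof. by elim: n => // n IHn; rewrite !expgS pi_mredM IHn. Qed.

Lemma pi_mred_prod (s : seq H) :
  \pi_(mred H) (\prod_(x <- s) x) = \prod_(x <- s) \pi_(mred H) x.
Proof. by apply: (big_morph _ pi_mredM). Qed.

Lemma mdvd_pi a b : mdvd (\pi_(mred H) a) (\pi_(mred H) b) <-> mdvd a b.
Proof.
split=> [[u]|[c ->]]; last by rewrite pi_mredM; apply: mdvd_mulr.
have [c ->] := mred_ex u; rewrite -pi_mredM => /eqP/mred_eqP[e [f ef] h].
by exists (c * f); rewrite mulgA h -mulgA ef mulg1.
Qed.

Lemma munit_pi a : munit (\pi_(mred H) a) <-> munit a.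
Proof.
split=> [[u hu]|[b ab]]; last by exists (\pi b); rewrite -pi_mredM ab.
have /mdvd_pi[b ab] : mdvd (\pi_(mred H) a) (\pi_(mred H) 1) by exists u; rewrite hu.
by exists b.
Qed.

Lemma munit_mred u : munit u -> u = 1.
Proof.
have [a ->] := mred_ex u; move=> /munit_pi[b ab].
by apply/eqP/mred_eqP; exists b; [exists a; rewrite cmonC | rewrite ab].
Qed.

Lemma absorbs_pi a n : absorbs a n -> absorbs (\pi_(mred H) a) n.
Proof.
move=> an s sN ns.
have -> : \prod_(u <- s) u = \pi_(mred H) (\prod_(x <- map repr s) x).
  by rewrite pi_mred_prod big_map; apply: eq_bigr => u _; rewrite reprK.
apply/mdvd_pi/an; last by rewrite size_map.
by move=> x /mapP[u us ->] /munit_pi; rewrite reprK; apply: sN.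
Qed.

Lemma strongly_primary_mred : strongly_primary H -> strongly_primary (mred H).
Proof.
move=> sp u; have [a ->] := mred_ex u; have [n /absorbs_pi an] := sp a.
by exists n.
Qed.

End Reduced.

(** * Factorizations and tame degrees *)

Section Factorizations.
Local Open Scope group_scope.
Local Open Scope mset_scope.
Local Open Scope quotient_scope.
Variable H : cmonoidType.
Implicit Types (a b : H) (u : red_atom H) (y z w : {mset red_atom H}).

Lemma size_seq_mset (K : choiceType) (s : seq K) : size (seq_mset s) = size s.
Proof. exact/perm_size/perm_eq_seq_mset. Qed.

Lemma perm_msetD (K : choiceType) (A B : {mset K}) : perm_eq (A `+` B) (A ++ B).
Proof.
by apply/allP => x _ /=; rewrite count_cat !count_mem_mset msetE2.
Qed.

Lemma size_msetD (K : choiceType) (A B : {mset K}) :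
  size (A `+` B) = (size A + size B)%N.
Proof. by rewrite (perm_size (perm_msetD A B)) size_cat. Qed.

Lemma size_msetS (K : choiceType) (A B : {mset K}) :
  A `<=` B -> (size A <= size B)%N.
Proof. by move=> /msetBDKC <-; rewrite size_msetD leq_addr. Qed.

Lemma fact_piD z w : fact_pi (z `+` w) = fact_pi z * fact_pi w.
Proof. by rewrite /fact_pi (perm_big _ (perm_msetD z w)) big_cat. Qed.

Lemma fact_pi1 u : fact_pi [mset u] = val u.
Proof. by rewrite /fact_pi enum_msetn big_seq1. Qed.

Lemma red_atomP u : matom (val u). Proof. exact/asboolP/(valP u). Qed.

Lemma red_atoms_nonunit (s : seq (red_atom H)) :
  {in map val s, forall x, ~ munit x}.
Proof. by move=> x /mapP[u _ ->]; case: (red_atomP u). Qed.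

Lemma absorbs_fact (v : mred H) n z :
  absorbs v n -> (n <= size z)%N -> mdvd v (fact_pi z).
Proof.
move=> vn nz; rewrite /fact_pi -(big_map val predT id); apply: vn.
  exact: red_atoms_nonunit.
by rewrite size_map.
Qed.

Lemma fact_length_bound (v : mred H) n z :
  absorbs v n -> fact_pi z = v -> (size z <= n)%N.
Proof.
move=> vn zv; rewrite -(size_map val).
apply: (absorbs_length vn (@red_atoms_nonunit _)).
by rewrite -zv /fact_pi big_map.
Qed.

Lemma mred_factorization (v : mred H) :
  strongly_primary H -> exists z, fact_pi z = v.
Proof.
move=> sp; have [/munit_mred ->|vN] := pselect (munit v).
  by exists mset0; rewrite /fact_pi enum_mset0 big_nil.
have [s sA <-] := atomic_factorization (strongly_primary_mred sp) vN.
elim: s sA => [|x s IHs] sA.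
  by exists mset0; rewrite /fact_pi enum_mset0 !big_nil.
have [|z zs] := IHs; first by move=> y ys; apply: sA; rewrite in_cons ys orbT.
have xA : `[< matom x >] by apply/asboolP/sA/mem_head.
exists ([mset Sub x xA] `+` z); rewrite fact_piD fact_pi1 zs big_cons.
by rewrite SubK.
Qed.

Lemma factorization_ex a : strongly_primary H -> exists z, factorizations a z.
Proof. exact: mred_factorization. Qed.

Definition has_fact N a := exists2 z, factorizations a z & (size z <= N)%N.

Lemma has_fact_le M N a : (M <= N)%N -> has_fact M a -> has_fact N a.
Proof. by move=> MN [z za zM]; exists z => //; apply: leq_trans MN. Qed.

Lemma has_factM M N a b :
  has_fact M a -> has_fact N b -> has_fact (M + N) (a * b).
Proof.
move=> [z za zM] [w wb wN]; exists (z `+` w).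
  by rewrite /factorizations/= fact_piD za wb pi_mredM.
by rewrite size_msetD leq_add.
Qed.

Lemma has_fact1 : has_fact 0 (1 : H).
Proof.
exists mset0; last by rewrite enum_mset0.
by rewrite /factorizations/= /fact_pi enum_mset0 big_nil.
Qed.

Lemma has_factX N a k : has_fact N a -> has_fact (k * N) (a ^+ k).
Proof.
move=> aN; elim: k => [|k IHk]; first exact: has_fact1.
by rewrite expgS mulSn; apply: has_factM.
Qed.

(** A factorization with n or more atoms would force q to divide a. *)
Lemma has_fact_ndvd q n a :
  strongly_primary H -> absorbs q n -> ~ mdvd q a -> has_fact n a.
Proof.
move=> sp qn qa; have [z za] := factorization_ex a sp; exists z => //.
rewrite leqNgt; apply/negP => nz; apply/qa/mdvd_pi; rewrite -za.
exact: absorbs_fact (absorbs_pi qn) (ltnW nz).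
Qed.

Lemma Lambda_finite :
  Lambda H <> natbar_oo <-> exists N, forall a, has_fact N a.
Proof.
rewrite natbar_sup_neqoo; split=> -[N hN]; exists N => a.
  have /hN : [set natbar_min (set_of_lengths a) | a in [set: H]]%classic
    (natbar_min (set_of_lengths a)) by exists a.
  by move=> /natbar_min_le[_ [z za <-] zN]; exists z.
move=> [b _ <-]; apply/natbar_min_le; have [z zb zN] := hN b.
by exists (size z) => //; exists z.
Qed.

Lemma tame_bound_le u M N : (M <= N)%N -> tame_bound u M -> tame_bound u N.
Proof.
move=> MN uM a z az za; have [z' z'a zz'] := uM a z az za.
by exists z' => //; apply: leq_trans MN.
Qed.

Lemma locally_tameE : locally_tame H <-> forall u, exists N, tame_bound u N.
Proof. by split=> h u; apply/natbar_min_neqoo/h. Qed.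

Lemma globally_tameE : globally_tame H <-> exists N, forall u, tame_bound u N.
Proof.
rewrite /globally_tame natbar_sup_neqoo; split=> -[N hN]; exists N.
  move=> u; have /hN/natbar_min_le[n un nN] :
    [set tame_degree u | u in [set: red_atom H]]%classic (tame_degree u) by exists u.
  exact: tame_bound_le un.
by move=> _ [u _ <-]; apply/natbar_min_le; exists N.
Qed.

Lemma globally_locally_tame : globally_tame H -> locally_tame H.
Proof. by move=> /globally_tameE[N hN]; apply/locally_tameE => u; exists N. Qed.

Lemma fact_dist_common z z' w :
  (fact_dist (z `+` w) (z' `+` w) <= maxn (size z) (size z'))%N.
Proof.
rewrite /fact_dist /fact_length -msetDIl !msetBDr.
by rewrite geq_max !leq_max !(size_msetS (msubsetDl _ (z `&` z'))) orbT.
Qed.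

(** To make u appear in a factorization of a multiple of u, it is enough to
    rewrite a part y of it with at most n atoms: the first n atoms if there are
    that many, the whole factorization otherwise.  The rest is common to both
    factorizations and does not count in the distance. *)
Lemma tame_bound_exchange u n K :
  absorbs (val u) n ->
  (forall y, (size y <= n)%N -> mdvd (val u) (fact_pi y) ->
     exists2 w, fact_pi ([mset u] `+` w) = fact_pi y &
                (size ([mset u] `+` w) <= K)%N) ->
  tame_bound u (maxn n K).
Proof.
move=> un exch a z [z0 [z0a [w0 z0E]]] za.
pose y := seq_mset (take n z); pose r := seq_mset (drop n z).
have zE : z = y `+` r.
  rewrite -[LHS]seq_mset_id -{1}(cat_take_drop n z).
  by apply/msetP => x; rewrite msetE2 !mset_seqE count_cat.
have yn : (size y <= n)%N by rewrite size_seq_mset size_take geq_minl.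
have uy : mdvd (val u) (fact_pi y).
  have [nz|zn] := leqP n (size z).
    by apply: absorbs_fact un _; rewrite size_seq_mset size_takel.
  have -> : y = z by rewrite /y take_oversize ?seq_mset_id // ltnW.
  rewrite za -z0a z0E fact_piD fact_pi1; exact: mdvd_mulr.
have [w wy wK] := exch y yn uy.
exists (([mset u] `+` w) `+` r).
  split; last by exists (w `+` r); rewrite msetDA.
  by rewrite /factorizations /= fact_piD wy -fact_piD -zE.
rewrite {1}zE; apply: leq_trans (fact_dist_common _ _ _) _.
by rewrite geq_max !leq_max yn wK orbT.
Qed.

(** The cofactor of u in the rewritten part has a factorization of length at
    most N, hence the tame degree of u is at most max(n, N+1). *)
Lemma locally_tame_of_bounded N :
  strongly_primary H -> (forall a, has_fact N a) -> locally_tame H.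
Proof.
move=> sp hN; apply/locally_tameE => u.
have [n un] := strongly_primary_mred sp (val u).
exists (maxn n N.+1); apply: tame_bound_exchange un _ => y _ [v ->].
have [a ->] := mred_ex v; have [w wa wN] := hN a; exists w.
  by rewrite fact_piD fact_pi1 wa.
by rewrite size_msetD enum_msetn.
Qed.

(** If n works for all atoms, then n^2 works for a product of n atoms, which
    bounds the length of all factorizations of the rewritten part. *)
Lemma globally_tame_of_absorbs n :
  strongly_primary H -> (forall u, absorbs (val u) n) -> globally_tame H.
Proof.
move=> sp hn; apply/globally_tameE; exists (maxn n (n * n)) => u.
apply: tame_bound_exchange (hn u) _ => y yn [v yv].
have [w wv] := mred_factorization v sp; exists w; first by rewrite fact_piD fact_pi1 wv.
have absy : absorbs (fact_pi y) (size y * n).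
  rewrite /fact_pi; elim: (enum_mset y) => [|x s IHs].
    by rewrite big_nil; apply: absorbs1.
  by rewrite big_cons mulSn; apply: absorbsM.
apply: leq_trans (_ : size y * n <= _)%N; last by rewrite leq_mul2r yn orbT.
by apply: fact_length_bound absy _; rewrite yv fact_piD fact_pi1 wv.
Qed.

(** All the atoms of a short factorization of p^k divide p^(T+1), where T is a
    global bound for the tame degrees; this bounds k. *)
Lemma not_globally_tame_of_bounded N (q : H) :
  strongly_primary H -> ~ munit q -> (forall a, has_fact N a) ->
  ~ globally_tame H.
Proof.
move=> sp qN hN /globally_tameE[T tame].
have [p pA] : exists p : red_atom H, True.
  have [z zq] := factorization_ex q sp.
  case def_z: (enum_mset z) => [|p s]; last by exists p.
  case: qN; apply/munit_pi; rewrite -zq /fact_pi def_z big_nil.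
  by exists 1; rewrite mulg1.
have pN : ~ munit (val p) by case: (red_atomP p).
pose k := (T.+1 * N).+1.
have [a aE] := mred_ex (val p ^+ k).
pose z := msetn k p.
have za : factorizations a z.
  by rewrite /factorizations/= /fact_pi enum_msetn -aE big_nseq -Monoid.iteropE.
have [z0 z0a z0N] := hN a.
have dvdp u : u \in enum_mset z0 -> mdvd (val u) (val p ^+ T.+1).
  move=> uz0; have [] := tame u a z _ za.
    by exists z0; split=> //; exists (z0 `\ u); rewrite msetB1K.
  move=> z' [z'a [w z'E]] dist.
  have [<-|up] := eqVneq u p; first by rewrite expgS; apply: mdvd_mulr.
  (* Since u is not p, it survives in z' after cancelling the gcd, so it divides
     what remains of z, a power of p with exponent at most T. *)
  pose g := z `&` z'.
  have zg : z = g `+` (z `\` g) by rewrite msetBDKC // msubsetIl.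
  have z'g : z' = g `+` (z' `\` g) by rewrite msetBDKC // msubsetIr.
  have ug : u \in z' `\` g.
    have uz' : u \in z' by rewrite z'E in_mset1D eqxx.
    have : u \notin g.
      by rewrite in_msetI negb_and /z in_msetn (negPf up) andbF.
    move=> ug; move: uz'; rewrite {1}z'g in_msetD (negPf ug) //.
  have eqpi : fact_pi (z' `\` g) = fact_pi (z `\` g).
    apply: (@cmonI _ (fact_pi g)).
    by rewrite -!fact_piD -zg -z'g z'a za.
  have -> : val p ^+ T.+1 = fact_pi (z `\` g) * val p ^+ (T.+1 - size (z `\` g)).
    have [j hj] : exists j, z `\` g = msetn j p.
      exists ((z `\` g) p); apply/msetP => x; rewrite msetnE.
      case: eqP => [-> //|/eqP xp]; apply/eqP; rewrite mset_eq0.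
      by apply/negP => /(msubset_subset (msubsetDl _ _)); rewrite in_msetn (negPf xp) andbF.
    have jT : (j <= T)%N.
      apply: leq_trans dist; rewrite /fact_dist leq_max; apply/orP; left.
      by rewrite -/g hj /fact_length enum_msetn size_nseq.
    rewrite hj enum_msetn size_nseq /fact_pi enum_msetn.
    rewrite -(big_map val predT id) map_nseq prodg_nseq -expgnDr.
    by rewrite subnKC // ltnW.
  apply: mdvd_trans (mdvd_mulr _ _); rewrite -eqpi /fact_pi -(big_map val predT id).
  by apply: mdvd_prod; apply: map_f.
have : mdvd (val p ^+ k) (val p ^+ (T.+1 * N)).
  apply: mdvd_trans (mdvd_exp2l _ (_ : T.+1 * size z0 <= _)%N); last by rewrite leq_mul2l z0N orbT.
  rewrite aE -z0a /fact_pi.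
  elim: (enum_mset z0) dvdp => [|x s IHs] dvdp.
    by rewrite big_nil; apply: mdvd1.
  rewrite big_cons /= mulnS expgnDr; apply: mdvd_mul; first exact/dvdp/mem_head.
  by apply: IHs => y ys; apply: dvdp; rewrite in_cons ys orbT.
by move/(mdvd_exp_leq pN); rewrite ltnn.
Qed.

End Factorizations.
(** * Powers of a fixed nonunit *)

Section Saturation.
Local Open Scope group_scope.
Local Open Scope quotient_scope.
Variables (H : cmonoidType) (q : H).
Hypotheses (sp : strongly_primary H) (qN : ~ munit q).
Implicit Types (a b d u x y : H).

(** In the quotient group, with z = b / q^L: all powers of z have denominator
    dividing q^L, and z itself has exactly this denominator. *)
Definition saturated L b :=
  ~ mdvd q b /\ forall i, mdvd (q ^+ (L * i)) (b ^+ i.+1).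

Definition power_splits k C := exists x y r,
  [/\ q ^+ k = x * y * q ^+ r, ~ mdvd q x, ~ mdvd q y & (r <= C)%N].

(** Writing a = q^k e with e q-free, the power q^k splits and a becomes a
    product of three q-free elements and a bounded power of q, all of which
    have factorizations of bounded length. *)
Lemma bounded_of_power_splits C :
  (forall k, power_splits k C) -> exists N, forall a, has_fact N a.
Proof.
move=> hC; have [n qn] := sp q; have [z zq] := factorization_ex q sp.
exists (n + n + C * size z + n)%N => a.
have [k [e [-> qe]]] := order_ex a sp qN.
have [x [y [r [-> qx qy rC]]]] := hC k.
apply: has_factM; last exact: has_fact_ndvd qe.
apply: has_factM.
  by apply: has_factM; [apply: has_fact_ndvd qx | apply: has_fact_ndvd qy].
apply: has_fact_le (has_factX r (ex_intro2 _ _ z zq (leqnn _))).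
by rewrite leq_mul2r rC orbT.
Qed.

(** Take i minimal such that a divides q^i: if q divided the cofactor d, then i
    could be lowered. *)
Lemma min_power a : exists i d, q ^+ i = a * d /\ (~ mdvd q d).
Proof.
have [n /(absorbs_exp qN) an] := sp a.
have exn : exists n, `[< mdvd a (q ^+ n) >] by exists n; apply/asboolP.
case: (ex_minnP exn) => i /asboolP[d ad] imin; exists i, d; split=> // -[e de].
case: i => [|i] in ad imin *.
  apply: qN; exists (a * e); rewrite -[RHS](expg0 q) ad de.
  by rewrite !mulgA (cmonC q).
have : (i.+1 <= i)%N; last by rewrite ltnn.
apply/imin/asboolP; exists e; apply: (@cmonI _ q).
by rewrite -expgS ad de !mulgA (cmonC q).
Qed.

(** Suppose there is no such B, let u divide q^i and fix k.  At the first m for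
    which the q-free part x of u^m does not divide q^k, the q-free part x' of
    the previous power divides q^k.  As x divides x' u, the least p with x'
    dividing q^p satisfies k - i < p <= k, and q^p is the product of x' and a
    q-free cofactor.  So every k splits up to a power of q bounded by i. *)
Lemma bounded_parts u : ~ (exists N, forall a, has_fact N a) ->
  exists B, forall m f x, u ^+ m = q ^+ f * x -> ~ mdvd q x -> mdvd x (q ^+ B).
Proof.
move=> unb; apply: contrapT => noB; apply: unb.
have [i uqi] : exists i, mdvd u (q ^+ i).
  by have [i [d [ud _]]] := min_power u; exists i, d.
apply: (@bounded_of_power_splits i) => k.
pose P m := exists f x, [/\ u ^+ m = q ^+ f * x, ~ mdvd q x & ~ mdvd x (q ^+ k)].
have exP : exists m, `[< P m >].
  apply: contrapT => noP; apply: noB; exists k => m f x ux qx.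
  by apply: contrapT => xk; apply: noP; exists m; apply/asboolP; exists f, x.
case: (ex_minnP exP) => -[|m] /asboolP[f [x [ux qx xk]]] mmin.
  case: xk; apply: mdvd_trans (mdvd1 _); rewrite -[1]/(u ^+ 0) ux.
  exact: mdvd_mull.
have [f' [x' [ux' qx']]] := order_ex (u ^+ m) sp qN.
have x'k : mdvd x' (q ^+ k).
  apply: contrapT => x'k; suff : (m.+1 <= m)%N by rewrite ltnn.
  by apply/mmin/asboolP; exists f', x'.
have f'f : (f' <= f)%N.
  apply: (order_geq _ qx); rewrite -ux expgSr ux' -mulgA; exact: mdvd_mulr.
have xx'u : mdvd x (x' * u).
  exists (q ^+ (f - f')); apply: (@cmonI _ (q ^+ f')).
  rewrite mulgA -ux' -expgSr ux -{1}(subnKC f'f) expgnDr -mulgA.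
  by rewrite (cmonC x).
have [p [y [qpE qy]]] := min_power x'.
have pk : (p <= k)%N.
  have [c kE] := x'k; rewrite leqNgt; apply/negP => kp; apply: qy.
  exists (c * q ^+ (p - k.+1)); apply: (@cmonI _ x').
  rewrite -qpE -{1}(subnKC kp) addSn expgS expgnDr kE.
  by rewrite !mulgA (cmonC q).
have kpi : (k <= p + i)%N.
  rewrite leqNgt; apply/negP => pik; apply: xk.
  apply: mdvd_trans (mdvd_exp2l q (ltnW pik)); apply: mdvd_trans xx'u _.
  by rewrite expgnDr; apply: mdvd_mul => //; rewrite qpE; apply: mdvd_mulr.
exists x', y, (k - p)%N; split=> //; last by rewrite leq_subLR.
by rewrite -qpE -expgnDr subnKC.
Qed.

Section NoSaturated.
Variable L0 : nat.
Hypothesis L0_gt0 : (0 < L0)%N.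
Hypothesis unsaturated : forall L b, (L0 <= L)%N -> ~ saturated L b.

(** Let f(m) be the exponent of q in d^m.  If q^(m L0) divided d^m, the
    differences m L0 - f(m) would be bounded above.  At an m1 where their
    maximum L is attained, the q-free part of d^m1 is saturated at level L, and
    L >= L0 because m = 1 contributes L0: this is excluded. *)
Lemma power_order d m :
  ~ mdvd q d -> (0 < m)%N -> ~ mdvd (q ^+ (m * L0)) (d ^+ m).
Proof.
move=> qd m_gt0 qdm.
pose P g := exists m' f x, [/\ (0 < m')%N, d ^+ m' = q ^+ f * x, ~ mdvd q x
  & (m' * L0 - f)%N = g].
have P1 : P L0.
  by exists 1%N, 0%N, d; rewrite mul1g mul1n subn0.
have exP : exists g, `[< P g >] by exists L0; apply/asboolP.
have bnd g : `[< P g >] -> (g <= m * L0)%N.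
  move=> /asboolP[m' [f [x [m'_gt0 dE qx <-]]]].
  have : (m' %/ m * (m * L0) <= f)%N.
    apply: (order_geq _ qx); rewrite -dE {2}(divn_eq m' m) expgnDr.
    apply: mdvd_trans (mdvd_mulr _ _).
    by rewrite mulnC (mulnC _ m) (expgnA q) (expgnA d); apply: mdvd_exp.
  have := ltn_pmod m' m_gt0; have := divn_eq m' m; nia.
case: (ex_maxnP exP bnd) => L /asboolP[m1 [f [b [m1_gt0 dE qb LE]]]] Lmax.
have L0L : (L0 <= L)%N by apply/Lmax/asboolP.
apply: (unsaturated L0L (b := b)); split=> // i.
have [f' [x [dE' qx]]] := order_ex (d ^+ (m1 * i.+1)) sp qN.
have : (m1 * i.+1 * L0 - f' <= L)%N.
  by apply/Lmax/asboolP; exists (m1 * i.+1)%N, f', x; rewrite muln_gt0 m1_gt0.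
move=> hL; have hf : (f * i.+1 + L * i <= f')%N by nia.
apply: (@mdvd_mul2l _ (q ^+ (f * i.+1))); rewrite -expgnDr expgnA.
rewrite -(expgMn _ (cmonC _ _)) -dE -expgnA dE'.
by apply: mdvd_trans (mdvd_exp2l q hf) (mdvd_mulr _ _).
Qed.

(** Let a be q-free and q^i = a d with i minimal.  Then d is q-free too, so the
    exponents of q in a^m and d^m are below m L0.  The q-free part of a^m
    divides q^B for all m, whence d^m = q^(i m) / a^m is divisible by
    q^(i m - m L0 - B).  For large m, here m = B + 1, this forces i <= 2 L0. *)
Lemma dvd_fixed_power a : ~ (exists N, forall a, has_fact N a) ->
  ~ mdvd q a -> mdvd a (q ^+ (2 * L0)).
Proof.
move=> unb qa; have [i [d [qiE qd]]] := min_power a.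
suff iL : (i <= 2 * L0)%N.
  by apply: mdvd_trans (mdvd_exp2l q iL); rewrite qiE; apply: mdvd_mulr.
rewrite leqNgt; apply/negP => iL; have [B hB] := bounded_parts a unb.
apply: (@power_order d B.+1) => //.
have [f [x [aE qx]]] := order_ex (a ^+ B.+1) sp qN.
have fL : (f < B.+1 * L0)%N.
  rewrite ltnNge; apply/negP => Lf; apply: (@power_order a B.+1) => //.
  by rewrite aE; apply: mdvd_trans (mdvd_exp2l q Lf) (mdvd_mulr _ _).
have [c xc] := hB _ _ _ aE qx.
apply: (@mdvd_mul2l _ (q ^+ (f + B))).
have -> : q ^+ (f + B) * d ^+ B.+1 = c * q ^+ (i * B.+1).
  rewrite (expgnA q i) qiE (expgMn _ (cmonC _ _)) aE expgnDr xc.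
  by rewrite !mulgA; congr (_ * _); rewrite cmonC !mulgA.
apply: mdvd_trans (mdvd_mull _ _); rewrite -expgnDr; apply: mdvd_exp2l.
nia.
Qed.

End NoSaturated.

(** If the levels of saturated elements were unbounded, all even powers of q
    would be products of two q-free elements; odd ones need one more factor q.
    Otherwise every atom divides q^(2 L0): the q-free ones by
    [dvd_fixed_power], and an atom divisible by q is associated to q. *)
Lemma globally_tame_of_unbounded :
  (forall L b j, saturated L b -> (0 < j < L)%N -> power_splits (2 * j) 0) ->
  ~ (exists N, forall a, has_fact N a) -> globally_tame H.
Proof.
move=> satsplit unb.
have [L0 [L0_gt0 hL0]] : exists L0, (0 < L0)%N /\
    forall L b, (L0 <= L)%N -> ~ saturated L b.
  apply: contrapT => noL0; apply: unb; apply: (@bounded_of_power_splits 1) => k.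
  have [] : power_splits (2 * k./2) 0.
    have [->|k2] := posnP k./2.
      exists 1, 1, 0%N; rewrite !mulg1; split=> // -[c hc]; apply: qN; by exists c.
    apply: contrapT => nosplit; apply: noL0; exists k.+2; split=> // L b kL sat.
    by apply: nosplit; apply: satsplit sat _; lia.
  move=> x [y [r [E qx qy]]]; rewrite leqn0 => /eqP r0.
  exists x, y, (odd k : nat); split=> //; last by case: odd.
  rewrite -{1}(odd_double_half k) -mul2n addnC expgnDr E r0 mulg1 //.
have [n qn] := sp q.
apply: (@globally_tame_of_absorbs _ (2 * L0 * n)) => // u.
have [a aE] := mred_ex (val u).
apply: absorbs_dvd _ (absorbsX (k := 2 * L0) (absorbs_pi qn)).
rewrite -pi_mredX aE.
have [[c ac]|qa] := pselect (mdvd q a); last first.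
  exact/mdvd_pi/(dvd_fixed_power L0_gt0).
have [_ uA] := red_atomP u.
have [|/munit_pi//|[e he]] := uA (\pi q) (\pi c); first by rewrite -pi_mredM -ac.
apply: (@mdvd_trans _ (\pi_(mred H) q)).
  by rewrite ac pi_mredM; exists e; rewrite -mulgA he mulg1.
apply/mdvd_pi; rewrite -{1}(expg1 q); apply: mdvd_exp2l; lia.
Qed.

End Saturation.
(** * Ideals of a domain *)

Import GRing.Theory.

Section Ideals.
Local Open Scope ring_scope.
Local Open Scope classical_set_scope.
Variable R : idomainType.
Implicit Types (a x y r : R) (J S : set R).

Definition linear_set J := J 0 /\ forall r x y, J x -> J y -> J (r * x + y).

Lemma linear_setM J r x : linear_set J -> J x -> J (r * x).
Proof. by move=> [J0 JD] Jx; rewrite -[_ * _]addr0; apply: JD. Qed.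

Lemma linear_set_idealr_closed J :
  linear_set J -> ~ J 1 -> idealr_closed (fun x => `[< J x >]).
Proof.
move=> [J0 JD] J1; split; first exact/asboolP.
  by apply/asboolP.
by move=> r x y /asboolP Jx /asboolP Jy; apply/asboolP/JD.
Qed.

Lemma linear_set_idealr J : linear_set J -> ~ J 1 ->
  exists I : idealr R, forall x, (x \in I) <-> J x.
Proof.
move=> lJ J1; pose f x := `[< J x >].
pose I : idealr R := HB.pack f (isIdealr.Build R f (linear_set_idealr_closed lJ J1)).
by exists I => x; split=> /asboolP.
Qed.

Lemma linear_set_prime_idealr J : linear_set J -> ~ J 1 ->
  (forall x y, J (x * y) -> J x \/ J y) ->
  exists I : prime_idealr R, forall x, (x \in I) <-> J x.
Proof.
move=> lJ J1 Jp; pose f x := `[< J x >].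
have fp : prime_idealr_closed f.
  by move=> x y /asboolP/Jp[] Jx; apply/orP; [left|right]; apply/asboolP.
pose I : prime_idealr R := HB.pack f
  (isIdealr.Build R f (linear_set_idealr_closed lJ J1))
  (isPrimeIdealrClosed.Build R f fp).
by exists I => x; split=> /asboolP.
Qed.

Lemma idealr_linear_set (I : idealr R) : linear_set [set x | x \in I].
Proof.
split=> [|r x y /= xI yI]; first exact: idealr0.
by rewrite rpredD // idealMr.
Qed.

(** Zorn's lemma cannot be applied directly to the ideals containing a and
    avoiding S, since the union of the empty chain is empty; it is applied to
    the sets whose union with aR is such an ideal. *)
Lemma ideal_avoiding S a : (forall r, ~ S (r * a)) ->
  exists J, [/\ linear_set J, J a, forall x, J x -> ~ S x &
    forall J', linear_set J' -> J `<=` J' -> (forall x, J' x -> ~ S x) ->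
      J' `<=` J].
Proof.
move=> aS; pose aR := [set x | exists r, x = r * a].
pose P A := linear_set (A `|` aR) /\ forall x, (A `|` aR) x -> ~ S x.
have aR_lin : linear_set aR.
  split=> [|r x y [s ->] [t ->]]; first by exists 0; rewrite mul0r.
  by exists (r * s + t); ring.
have [F FP Ftot|A [[Alin AS] Amax]] := @Zorn_bigcup _ P.
  split; last first.
    move=> x [[X FX Xx]|[r ->]]; last exact: aS.
    by apply: (FP _ FX).2; left.
  split=> [|r x y]; first by right; apply: aR_lin.1.
  have one X : F X -> X `|` aR `<=` \bigcup_(X in F) X `|` aR.
    by move=> FX z [Xz|az]; [left; exists X | right].
  move=> [[X FX Xx]|ax] [[Y FY Yy]|ay].
  - have [XY|YX] := Ftot X Y FX FY.
      by apply: (one Y FY); apply: (FP Y FY).1.2; left => //; apply: XY.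
    by apply: (one X FX); apply: (FP X FX).1.2; left => //; apply: YX.
  - by apply: (one X FX); apply: (FP X FX).1.2; [left|right].
  - by apply: (one Y FY); apply: (FP Y FY).1.2; [right|left].
  - by right; apply: aR_lin.2.
exists (A `|` aR); split=> //; first by right; exists 1; rewrite mul1r.
move=> J' J'lin AJ' J'S x J'x; apply: contrapT => Ax.
have J'aR : J' `|` aR = J' by apply/setUidPl => y ay; apply: AJ'; right.
apply: (Amax J'); last by rewrite /P J'aR.
split; first by move=> y Ay; apply: AJ'; left.
by move=> /(_ x J'x) Ax'; apply: Ax; left.
Qed.

(** If J contains neither x nor y, both J + xR and J + yR meet S; the product of
    two common elements lies in S and, if J contains xy, also in J. *)
Lemma ideal_avoiding_prime S J : linear_set J ->
  (forall x y, S x -> S y -> S (x * y)) -> (forall x, J x -> ~ S x) ->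
  (forall J', linear_set J' -> J `<=` J' -> (forall x, J' x -> ~ S x) ->
     J' `<=` J) ->
  forall x y, J (x * y) -> J x \/ J y.
Proof.
move=> lJ Smul JS Jmax x y Jxy.
have adjoin z : ~ J z -> exists j r, J j /\ S (j + r * z).
  move=> Jz; apply: contrapT => noS; apply: Jz.
  pose J' := [set w | exists j r, J j /\ w = j + r * z].
  apply: (Jmax J'); last by exists 0, 1; rewrite add0r mul1r; split=> //; apply: lJ.1.
  - split=> [|s _ _ [j [r [Jj ->]]] [k [t [Jk ->]]]].
      by exists 0, 0; rewrite mul0r addr0; split=> //; apply: lJ.1.
    by exists (s * j + k), (s * r + t); split; [apply: lJ.2 | ring].
  - by move=> w Jw; exists w, 0; rewrite mul0r addr0.
  - by move=> _ [j [r [Jj ->]]] h; apply: noS; exists j, r.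
have [Jx|/adjoin[j [r [Jj Sx]]]] := pselect (J x); first by left.
have [Jy|/adjoin[k [t [Jk Sy]]]] := pselect (J y); first by right.
exfalso; apply: (JS _ _ (Smul _ _ Sx Sy)).
have -> : (j + r * x) * (k + t * y) =
  (k + t * y) * j + (r * x * k + (r * t) * (x * y)) by ring.
by apply: lJ.2 => //; apply: lJ.2 => //; apply: linear_setM.
Qed.

End Ideals.

(** * One-dimensional local Mori domains *)

Section OneDimLocal.
Local Open Scope ring_scope.
Local Open Scope classical_set_scope.
Variable R : idomainType.
Hypotheses (hdim : krull_dim R = Some 1%N) (hloc : local_domain R).
Implicit Types (a b x y r : R) (s t : seq R).

Definition nonunit x := x \isn't a GRing.unit.

Lemma idealr_nonunit (I : idealr R) x : x \in I -> nonunit x.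
Proof.
move=> xI; apply/negP => xU; have := idealr1 I.
by rewrite -(mulVr xU) idealMr.
Qed.

Lemma mem_maximal_ideal x : nonunit x ->
  exists2 M : idealr R, maximal_ideal M & x \in M.
Proof.
move=> xN; have [|J [lJ Jx J1 Jmax]] := @ideal_avoiding R [set 1] x.
  by move=> r /= rx1; apply: (negP xN); apply/unitrP; exists r; rewrite (mulrC x).
have [|I IJ] := linear_set_idealr lJ; first by move=> /J1; apply.
exists I; last exact/IJ.
move=> I' II' y; apply/idP/idP; last exact: II'.
move=> yI'; apply/IJ; apply: (Jmax _ (idealr_linear_set I') _ _ y yI').
  by move=> z /IJ/II'.
by move=> z /= zI' z1; move: zI'; rewrite z1 idealr1.
Qed.

Lemma local_max_ideal : exists M : idealr R, forall x, (x \in M) = nonunit x.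
Proof.
have [M _ Muniq] := hloc; exists M => x; apply/idP/idP.
  exact: idealr_nonunit.
by move=> /mem_maximal_ideal[M' /Muniq <-].
Qed.

Lemma nonunitM r x : nonunit x -> nonunit (r * x).
Proof. by rewrite /nonunit unitrM negb_and => ->; rewrite orbT. Qed.

Lemma unit1D x : nonunit x -> 1 + x \is a GRing.unit.
Proof.
have [M hM] := local_max_ideal; rewrite -hM => xM.
apply: negbNE; rewrite -/(nonunit _) -hM; apply/negP => h.
by have := rpredB h xM; rewrite addrK idealr1.
Qed.

Lemma prime_chain_bound n (P : 'I_n.+1 -> prime_idealr R) :
  prime_chain P -> (n <= 1)%N.
Proof.
move=> hP; have [h _] := (natbar_minP _ _).1 hdim.
by apply: (h (Some n)); exists n => //; exists P.
Qed.

Lemma nonzero_nonunit_ex : exists2 q : R, q != 0 & nonunit q.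
Proof.
have [_ h] := (natbar_minP _ _).1 hdim; apply: contrapT => noq.
suff : (1 <= 0)%N by [].
apply: h => _ [n [P hP] <-] /=; rewrite leqNgt; apply/negP => n0.
have [_ [x xP1 xP0]] := hP ord0 (Ordinal (n0 : 1 < n.+1)%N) isT.
apply: noq; exists x; last exact: idealr_nonunit xP1.
by apply/eqP => x0; move: xP0; rewrite x0 idealr0.
Qed.

Definition rdvd a x := exists r, x = a * r.

Lemma rdvd_mulr a x r : rdvd a x -> rdvd a (x * r).
Proof. by move=> [y ->]; exists (y * r); rewrite mulrA. Qed.

Lemma rdvd_mull a x r : rdvd a x -> rdvd a (r * x).
Proof. by rewrite mulrC; apply: rdvd_mulr. Qed.

(** Otherwise an ideal containing a and maximal among those avoiding the powers
    of x would be a prime lying strictly between 0 and the maximal ideal. *)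
Lemma nonunit_power_dvd a x : a != 0 -> nonunit x -> exists k, rdvd a (x ^+ k).
Proof.
move=> a0 xN; apply: contrapT => nok.
have [|J [lJ Ja JS Jmax]] := @ideal_avoiding R [set y | exists k, y = x ^+ k] a.
  by move=> r [k rE]; apply: nok; exists k, r; rewrite mulrC.
have J1 : ~ J 1 by move=> /JS; apply; exists 0%N.
have Jx : ~ J x by move=> /JS; apply; exists 1%N.
have Jp : forall y z, J (y * z) -> J y \/ J z.
  apply: ideal_avoiding_prime lJ _ JS Jmax => _ _ [i ->] [j ->].
  by exists (i + j)%N; rewrite exprD.
have [PJ hPJ] := linear_set_prime_idealr lJ J1 Jp.
have [P0 hP0] : exists I : prime_idealr R, forall y, (y \in I) <-> [set 0] y.
  apply: linear_set_prime_idealr => /=.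
  - by split=> // r y z /= -> ->; rewrite mulr0 addr0.
  - by move/eqP; rewrite oner_eq0.
  - by move=> y z /eqP; rewrite mulf_eq0 => /orP[]/eqP; [left|right].
have [M hM] := local_max_ideal.
have [PM hPM] : exists I : prime_idealr R, forall y, (y \in I) <-> y \in M.
  apply: (linear_set_prime_idealr (idealr_linear_set M)) => /=.
    by rewrite idealr1.
  move=> y z; rewrite !hM /nonunit unitrM negb_and => /orP.
  by case; [left|right].
pose P (i : 'I_3) := if i == 0 :> nat then P0 else if i == 1 :> nat then PJ else PM.
suff /prime_chain_bound : prime_chain P by [].
have JM y : J y -> y \in M by move=> /hPJ /idealr_nonunit; rewrite hM.
have sub01 : {subset P0 <= PJ} by move=> y /hP0 /= ->; apply: idealr0.
have sub12 : {subset PJ <= PM} by move=> y /hPJ /JM /hPM.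
have a1 : a \in PJ by apply/hPJ.
have a0' : a \notin P0 by apply/negP => /hP0 /= /eqP; apply/negP.
have x2 : x \in PM by apply/hPM; rewrite hM.
have x1 : x \notin PJ by apply/negP => /hPJ.
move=> [[|[|[|i]]] ilt] [[|[|[|j]]] jlt] //= ij; rewrite /P /=.
- by split=> //; exists a.
- by split; [move=> y /sub01/sub12 | exists a => //; apply: sub12].
- by split=> //; exists x.
Qed.

Hypothesis hmori : mori_domain R.

(** Were there no such E, one could build an infinite sequence of nonunits, each
    being outside of the divisorial closure of its predecessors; these
    closures would be a strictly increasing chain of divisorial ideals.  The
    fraction y / a is the element of the colon that detects the new term. *)
Lemma mori_finite_colon : exists E : seq R, {in E, forall e, nonunit e} /\
  forall a y, a != 0 -> {in E, forall e, rdvd a (y * e)} ->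
    forall x, nonunit x -> rdvd a (y * x).
Proof.
apply: contrapT => noE.
have /choice[next nextP] : forall E : seq R, exists x, nonunit x /\
    ({in E, forall e, nonunit e} ->
     exists a y, [/\ a != 0, {in E, forall e, rdvd a (y * e)} & ~ rdvd a (y * x)]).
  move=> E; have [EN|EN] := pselect {in E, forall e, nonunit e}; last first.
    by exists 0; split=> //; rewrite /nonunit unitr0.
  apply: contrapT => nox; apply: noE; exists E; split=> // a y a0 Ey x xN.
  by apply: contrapT => ayx; apply: nox; exists x; split=> // _; exists a, y.
pose E n := iter n (fun E => next E :: E) [::].
have EN n : {in E n, forall e, nonunit e}.
  elim: n => //= n IHn e; rewrite in_cons => /orP[/eqP ->|/IHn //].
  by case: (nextP (E n)).
pose X n : set {fraction R} := [set z | exists2 e, e \in E n & z = tofrac e].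
pose I n := colon (colon (X n)).
have Isub n m : (n <= m)%N -> I n `<=` I m.
  move=> nm z hz y hy; apply: hz => _ [e eE ->]; apply: hy; exists e => //.
  by rewrite -(subnK nm) /E iterD; elim: (m - n)%N => //= k IHk; rewrite in_cons IHk orbT.
have XI n : X n `<=` I n by move=> z zX y /(_ z zX); rewrite mulrC.
have [n||N hN] := @hmori I.
- split; last by exists (X n).
  move=> z /(_ 1); rewrite mulr1 => -[_ [e _ ->]|r ->]; last by exists r.
  by exists e; rewrite mul1r.
- by move=> n; apply: Isub.
have [_ /(_ (EN N))[a [y [a0 Ey nay]]]] := nextP (E N).
apply: nay.
have : I N (tofrac (next (E N))).
  by rewrite -(hN N.+1) //; apply: XI; exists (next (E N)) => //; apply: mem_head.
have aF : tofrac a != 0 :> {fraction R} by rewrite tofrac_eq0.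
move=> /(_ (tofrac y / tofrac a))[_ [e eE ->]|r rE].
  have [r rE] := Ey e eE; exists r.
  by rewrite mulrAC -tofracM rE tofracM mulrAC mulfV ?mul1r.
exists r; apply/eqP; rewrite -tofrac_eq !tofracM -rE; apply/eqP.
by rewrite !(mulrCA (tofrac a)) mulfV // mulr1 mulrC.
Qed.

(** Sufficiently long products over the finite set E contain a high power of
    some element of E, so they lie in aR.  By the choice of E, an arbitrary
    nonunit may then be substituted for any one factor from E while the
    others are kept, and so successively for all of them. *)
Lemma mori_strongly_primary a : a != 0 -> exists n, forall s,
  {in s, forall x, nonunit x} -> (n <= size s)%N -> rdvd a (\prod_(x <- s) x).
Proof.
move=> a0; have [E [EN Ecol]] := mori_finite_colon.
have [n hn] : exists n, forall t, {subset t <= E} -> (n <= size t)%N ->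
    rdvd a (\prod_(x <- t) x).
  elim: E EN {Ecol} => [|e E IHE] EN.
    by exists 1%N => -[|x t] // /(_ x (mem_head _ _)).
  have [|n hn] := IHE; first by move=> x xE; apply: EN; rewrite in_cons xE orbT.
  have [k ak] := nonunit_power_dvd a0 (EN e (mem_head _ _)).
  exists (k + n)%N => t tE tkn.
  rewrite -(perm_big _ (permEl (perm_filterC (pred1 e) t))) big_cat /=.
  have cnt : (count (pred1 e) t + count (predC (pred1 e)) t)%N = size t.
    exact: count_predC.
  have [kt|tk] := leqP k (count (pred1 e) t).
    apply: rdvd_mulr; rewrite big_filter (eq_bigr (fun=> e)); last by move=> i /eqP.
    by rewrite big_const_seq iter_mulr_1 -(subnKC kt) exprD; apply: rdvd_mulr.
  apply: rdvd_mull; apply: hn; last first.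
    rewrite size_filter -(leq_add2l (count (pred1 e) t)) cnt.
    by apply: leq_trans tkn; rewrite leq_add2r ltnW.
  move=> x; rewrite mem_filter /= => /andP[xe /tE].
  by rewrite in_cons (negPf xe).
exists n => s sN ns.
have := hn [::]; move: (leqnn n).
(* Invariant of the substitution: s holds the arbitrary nonunits, t those
   factors that are still taken from E. *)
suff gen : forall s t, {in s, forall x, nonunit x} -> {subset t <= E} ->
    (n <= size s + size t)%N -> rdvd a (\prod_(x <- t) x * \prod_(x <- s) x).
  move=> _ _; have := gen s [::] sN; rewrite big_nil mul1r addn0; exact.
move=> {ns sN} {}s; elim: s => [|x s IHs] t sN tE nst.
  by rewrite big_nil mulr1; apply: hn.
rewrite big_cons (mulrC x) mulrA; apply: Ecol => //; last exact/sN/mem_head.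
move=> e eE; rewrite mulrAC (mulrC _ e).
have := IHs (e :: t); rewrite big_cons; apply.
- by move=> y ys; apply: sN; rewrite in_cons ys orbT.
- by move=> y; rewrite in_cons => /orP[/eqP ->|/tE].
- by rewrite /= addnS -addSn.
Qed.

Notation nz := (nonzero R).

Definition nonzero_elt x (x0 : x != 0) : nz := exist _ x x0.

Lemma munit_nonzero (x : nz) : munit x <-> val x \is a GRing.unit.
Proof.
split=> [[y /(congr1 val) /= xy]|xU].
  by apply/unitrP; exists (val y); rewrite mulrC.
have y0 : (val x)^-1 != 0 by rewrite invr_eq0 (valP x).
by exists (nonzero_elt y0); apply: val_inj; rewrite /= mulrV.
Qed.

Lemma mdvd_nonzero (x y : nz) : mdvd x y <-> rdvd (val x) (val y).
Proof.
split=> [[z ->]|[r yE]]; first by exists (val z).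
have r0 : r != 0.
  by apply/eqP => r0; move: (valP y); rewrite yE r0 mulr0 eqxx.
by exists (nonzero_elt r0); apply: val_inj.
Qed.

Lemma val_nonzeroX (x : nz) n : val (x ^+ n)%g = val x ^+ n.
Proof. by elim: n => // n IHn; rewrite expgS exprS /= IHn. Qed.

Lemma val_nonzero_prod (s : seq nz) :
  val (\prod_(x <- s) x)%g = \prod_(x <- map val s) x.
Proof. by elim: s => [|x s IHs]; rewrite ?big_nil //= !big_cons /= IHs. Qed.

Lemma strongly_primary_nonzero : strongly_primary nz.
Proof.
move=> a; have [n hn] := mori_strongly_primary (valP a); exists n => s sN ns.
apply/mdvd_nonzero; rewrite val_nonzero_prod; apply: hn; last by rewrite size_map.
by move=> _ /mapP[x xs ->]; apply/negP => /munit_nonzero; apply: sN.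
Qed.

(** The factorization of Q^(j(L+2)) - (-B)^(L+2) into Q^j + B and a geometric
    sum.  By saturation each term of the sum is divisible by Q^(j L), and after
    division the terms of index 2 and more are still divisible by Q, leaving
    y = Q^j - B + Q s.  Likewise the difference is Q^(j(L+2)) times a unit of
    the form 1 + Q t; the exponent L+2 is large enough for this since
    L(L+1) > j(L+2) when j < L. *)
Lemma power_splits_of_saturated (q b : nz) L j : ~ munit q ->
  saturated q L b -> (0 < j < L)%N -> power_splits q (2 * j) 0.
Proof.
move=> qN [qb bL] /andP[j_gt0 jL].
pose Q := val q; pose B := val b.
have Q0 : Q != 0 by exact: valP q.
have /choice[r rE] : forall i, exists r, B ^+ i.+1 = Q ^+ (L * i) * r.
  move=> i; have /mdvd_nonzero := bL i.
  by rewrite !val_nonzeroX.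
pose s : R := \sum_(i < L) (-1) ^+ i * (Q ^+ ((L - j) * i.+1).-1 * r i.+1).
pose y := Q ^+ j - B + Q * s.
pose t := (-1) ^+ L.+1 * (Q ^+ (L * L.+1 - j * L.+2).-1 * r L.+1).
have QN : nonunit Q by apply/negP => /munit_nonzero.
have key : (Q ^+ j + B) * y = Q ^+ (2 * j) * (1 + Q * t).
  apply: (mulfI (expf_neq0 (j * L) Q0)).
  have sumE : \sum_(i < L.+2) (Q ^+ j) ^+ (L.+1 - i) * (- B) ^+ i = Q ^+ (j * L) * y.
    rewrite !big_ord_recl /= /bump /= !subn0 subSS subn0 expr0 mulr1 expr1.
    rewrite /y !mulrDr -!exprM addrA; congr (_ + _ + _).
      by rewrite mulnS exprD mulrC.
    rewrite /s !mulr_sumr; apply: eq_bigr => k _.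
    rewrite !add1n (exprNn B) rE -signr_odd /= negbK signr_odd -!exprM subSS.
    have expE : (j * (L - k.+1) + L * k.+1 = j * L + ((L - j) * k.+1).-1.+1)%N.
      have := ltn_ord k; nia.
    transitivity ((-1) ^+ k * (Q ^+ (j * (L - k.+1) + L * k.+1) * r k.+1)).
      by rewrite exprD; ring.
    by rewrite expE exprD exprS; ring.
  have tE : - (- B) ^+ L.+2 = Q ^+ (j * L.+2) * (Q * t).
    have expE : (L * L.+1 = j * L.+2 + (L * L.+1 - j * L.+2).-1.+1)%N by nia.
    rewrite (exprNn B) rE {1}expE exprD !exprS /t exprS; ring.
  have := subrXX (Q ^+ j) (- B) L.+2.
  rewrite opprK sumE tE -exprM => h.
  rewrite mulrCA -h (_ : j * L.+2 = j * L + 2 * j)%N; last nia.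
  by rewrite exprD; ring.
pose e := 1 + Q * t.
have eU : e \is a GRing.unit by apply: unit1D; rewrite mulrC nonunitM.
have xy : (Q ^+ j + B) * (y / e) = Q ^+ (2 * j) by rewrite mulrA key mulrK.
have : (Q ^+ j + B) * (y / e) != 0 by rewrite xy expf_neq0.
rewrite mulf_eq0 negb_or => /andP[x0 y0].
have QQj : Q ^+ j = Q * Q ^+ j.-1 by rewrite -exprS prednK.
exists (nonzero_elt x0).
exists (nonzero_elt y0), 0%N; split=> //.
- apply: val_inj; rewrite val_nonzeroX -/Q -xy /=.
  by rewrite mulr1.
- move=> /mdvd_nonzero[c /= cE]; apply/qb/mdvd_nonzero; exists (c - Q ^+ j.-1).
  by rewrite mulrBr -QQj -cE addrC addKr.
- move=> /mdvd_nonzero[c /= cE]; apply/qb/mdvd_nonzero.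
  exists (Q ^+ j.-1 + s - e * c); rewrite -/Q -/B.
  have : y = Q * c * e by rewrite -cE divrK.
  rewrite /y QQj => yE; apply/eqP; rewrite -subr_eq0; apply/eqP.
  rewrite (_ : B - _ = Q * c * e - (Q * Q ^+ j.-1 - B + Q * s)); last by ring.
  by rewrite yE subrr.
Qed.

Theorem nonzero_tame :
  locally_tame nz /\ (globally_tame nz <-> Lambda nz = natbar_oo).
Proof.
have sp := strongly_primary_nonzero.
have [q0 q0_neq0 q0N] := nonzero_nonunit_ex.
pose q := nonzero_elt q0_neq0.
have qN : ~ munit q by move=> /munit_nonzero; apply/negP.
have [[N hN]|unb] := pselect (exists N, forall a : nz, has_fact N a).
  split; first exact: locally_tame_of_bounded hN.
  split=> [/(not_globally_tame_of_bounded sp qN hN) //|Loo].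
  by case: ((Lambda_finite nz).2 (ex_intro _ N hN)).
have gt : globally_tame nz.
  by apply: (globally_tame_of_unbounded sp qN) unb => L b j; apply: power_splits_of_saturated.
split; first exact: globally_locally_tame.
split=> // _; apply: contrapT => /Lambda_finite; exact: unb.
Qed.

End OneDimLocal.

Theorem corollary3p10 (R : idomainType)
    (hdim : krull_dim R = Some 1%N) (hloc : local_domain R)
    (hmori : mori_domain R) :
  locally_tame (nonzero R) /\
  (globally_tame (nonzero R) <-> Lambda (nonzero R) = natbar_oo).
Proof. exact: nonzero_tame hdim hloc hmori. Qed.
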